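(* For every $n\geq 5$, the number of even involutions in $\mathfrak{I}_n$ that contain the pattern $132$ exactly once is $\binom{n-3}{1+2\lfloor (n-5)/4\rfloor}$. For every $n\geq 3$, the number of odd involutions in $\mathfrak{I}_n$ that contain the pattern $132$ exactly once is $\binom{n-3}{2\lfloor (n-3)/4\rfloor}$.
   Context: $\mathfrak{I}_n$ is the set of involutions ($\pi=\pi^{-1}$) in the symmetric group $\mathfrak{S}_n$, written in one-line notation $\pi_1\cdots\pi_n$. An occurrence of $132$ in $\pi$ is a triple of indices $i<j<k$ with $\pi_i<\pi_k<\pi_j$; ''contains $132$ exactly once'' means there is exactly one such triple. An inversion is a pair $i<j$ with $\pi_i>\pi_j$; $\pi$ is even (odd) if its number of inversions is even (odd). $\lfloor\cdot\rfloor$ is the floor function and $\binom{a}{b}=0$ if $b<0$ or $b>a$. *)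

(* Defs.v *)
From mathcomp Require Import all_boot all_fingroup.

Set Implicit Arguments.
Unset Strict Implicit.
Unset Printing Implicit Defensive.

(* A permutation of {1, ..., n} is represented by s : 'S_n, acting on
   'I_n = {0, ..., n-1}; shifting positions and values by one changes neither
   inversions nor pattern occurrences.  The comparisons below are those of nat,
   through the coercion 'I_n >-> nat. *)

Definition involution_perm (n : nat) (s : 'S_n) : bool := s == (s^-1)%g.

Definition occurrences132 (n : nat) (s : 'S_n) : {set 'I_n * 'I_n * 'I_n} :=
  [set t : 'I_n * 'I_n * 'I_n | let: (i, j, k) := t in (i < j < k) && (s i < s k < s j)].

Definition contains132_once (n : nat) (s : 'S_n) : bool :=
  #|occurrences132 s| == 1.

Definition inversions (n : nat) (s : 'S_n) : {set 'I_n * 'I_n} :=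
  [set p : 'I_n * 'I_n | let: (i, j) := p in (i < j) && (s j < s i)].

(* Parity is defined by counting inversions, not by the library's odd_perm,
   which counts cycles. *)
Definition even_by_inversions (n : nat) (s : 'S_n) : bool :=
  ~~ odd #|inversions s|.

Definition odd_by_inversions (n : nat) (s : 'S_n) : bool :=
  odd #|inversions s|.

(* Main.v *)
(**
Let [s] be an involution of {0, ..., n+1} with [s 0 = v + 1], and [t] the
involution of {0, ..., n-1} got by deleting the 2-cycle (0, v+1) and
renumbering.  The 132-occurrences of [s] starting at position 0 are the
inversions of [t] between values >= v, those using the value 0 correspond to
them by inversion, and the others are the occurrences of [t].  Hence [s] has
exactly one occurrence iff [t] has exactly one and no inversion between values
>= v.  If [s] fixes 0, deleting 0 turns the occurrences starting at 0 into
inversions, so exactly one occurrence forces s = 0 2 1 3 4 ... (in one-line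
notation).  Deleting a 2-cycle changes the sign.  So the numbers of involutions
with one occurrence and no inversion between values >= w obey a closed
recursion in n and w; as a function of the number c of deleted 2-cycles they
count lattice paths above a line, which the reflection principle evaluates as
'C(n - 3, c) - 'C(n - 3, c - 2) for w = n - 1.  The sum over c of a given
parity telescopes.
*)

Require Import Defs.
From mathcomp Require Import all_boot all_fingroup.
From mathcomp Require Import zify.

Set Implicit Arguments.
Unset Strict Implicit.
Unset Printing Implicit Defensive.

(** * Building permutations by inserting one entry *)

Lemma lift_perm_inj n (i j j' : 'I_n.+1) (s s' : 'S_n) :
  lift_perm i j s = lift_perm i j' s' -> j = j' /\ s = s'.
Proof.
move=> /permP eq_ss'; have := eq_ss' i; rewrite !lift_perm_id => eq_jj'.
split=> //; subst j'; apply/permP => k.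
by apply: (@lift_inj _ j); rewrite -!(lift_perm_lift i) eq_ss'.
Qed.

Lemma lift_perm_bij n (i : 'I_n.+1) :
  bijective (fun p : 'I_n.+1 * 'S_n => lift_perm i p.1 p.2).
Proof.
apply: inj_card_bij => [[j s] [j' s'] /lift_perm_inj [/= -> ->] //|].
by rewrite card_prod card_Sn card_ord card_Sn factS.
Qed.

Lemma sum_lift_perm n (i : 'I_n.+1) (F : 'S_n.+1 -> nat) :
  \sum_(s : 'S_n.+1) F s = \sum_j \sum_(t : 'S_n) F (lift_perm i j t).
Proof.
by rewrite pair_big /= (reindex _ (onW_bij _ (lift_perm_bij i))).
Qed.

(** * Inversion and occurrence counts under insertion *)

Definition ninv (w n : nat) (s : 'S_n) : nat :=
  \sum_(a < n) \sum_(b < n) ((a < b) && (w <= s b < s a)).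

Definition nocc (n : nat) (s : 'S_n) : nat :=
  \sum_(i < n) \sum_(j < n) \sum_(k < n) ((i < j < k) && (s i < s k < s j)).

Lemma card_inversions n (s : 'S_n) : #|inversions s| = ninv 0 s.
Proof.
rewrite /ninv pair_big /= -sum1_card big_mkcond /=.
by apply: eq_bigr => -[a b] _; rewrite inE; case: ifP.
Qed.

Lemma card_occurrences132 n (s : 'S_n) : #|occurrences132 s| = nocc s.
Proof.
rewrite /nocc pair_big pair_big /= -sum1_card big_mkcond /=.
by apply: eq_bigr => -[[i j] k] _; rewrite inE; case: ifP.
Qed.

Lemma ninv_eq0P w n (s : 'S_n) :
  reflect (forall a b : 'I_n, a < b -> w <= s b -> s a <= s b) (ninv w s == 0).
Proof.
rewrite sum_nat_eq0; apply: (iffP forallP) => [s0 a b ab wb | s0 a].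
  have := s0 a; rewrite sum_nat_eq0 => /forallP /(_ b) /=.
  by rewrite ab wb eqb0 /= -leqNgt.
rewrite sum_nat_eq0; apply/forallP => b /=; rewrite eqb0.
by apply/negP => /and3P[ab wb]; rewrite ltnNge s0.
Qed.

Lemma ninv_eq0_leq w w' n (s : 'S_n) :
  w <= w' -> ninv w s = 0 -> ninv w' s = 0.
Proof.
move=> ww' /eqP /ninv_eq0P s0; apply/eqP/ninv_eq0P => a b ab wb.
by apply: s0 => //; apply: leq_trans wb.
Qed.

(** The last two entries of an occurrence form an inversion and exceed its first entry, so both are
    at least 1. *)
Lemma nocc_ninv1 n (s : 'S_n) : ninv 1 s = 0 -> nocc s = 0.
Proof.
move=> /eqP /ninv_eq0P s0; apply: big1 => i _; apply: big1 => j _.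
apply: big1 => k _; apply/eqP; rewrite eqb0; apply/negP.
case/andP=> /andP[_ jk] /andP[ik]; rewrite ltnNge s0 //.
by apply: leq_trans ik.
Qed.

Lemma ninvV n (s : 'S_n) w :
  ninv w s^-1 = \sum_(a < n) \sum_(b < n) ((w <= a < b) && (s b < s a)).
Proof.
rewrite /ninv (reindex_inj (@perm_inj _ s)) exchange_big.
rewrite (reindex_inj (@perm_inj _ s)); apply: eq_bigr => a _.
by apply: eq_bigr => b _; rewrite !permK andbC.
Qed.

Lemma ninv0V n (s : 'S_n) : ninv 0 s^-1 = ninv 0 s.
Proof. by rewrite ninvV. Qed.

Lemma noccV n (s : 'S_n) : nocc s^-1 = nocc s.
Proof.
rewrite /nocc (reindex_inj (@perm_inj _ s)); apply: eq_bigr => i _.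
rewrite (reindex_inj (@perm_inj _ s)) exchange_big.
rewrite (reindex_inj (@perm_inj _ s)); apply: eq_bigr => j _.
by apply: eq_bigr => k _; rewrite !permK andbC.
Qed.

Lemma nocc_lift0 n (j : 'I_n.+1) (s : 'S_n) :
  nocc (lift_perm ord0 j s) = nocc s + ninv j s.
Proof.
rewrite /nocc big_ord_recl addnC; congr (_ + _).
  apply: eq_bigr => a _; rewrite big_ord_recl big1 ?add0n => [|c _]; last first.
    by rewrite ltn0.
  apply: eq_bigr => b _; rewrite big_ord_recl /= ltn0 andbF add0n;
    apply: eq_bigr => c _.
  by rewrite !lift_perm_lift /= /bump; lia.
rewrite big_ord_recl big1 // add0n; apply: eq_bigr => a _.
rewrite big_ord_recl /= ?ltn0 ?andbF add0n; apply: eq_bigr => b _.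
by rewrite !lift_perm_lift lift_perm_id /= /bump; lia.
Qed.

(** The new first entry [j] starts no counted inversion. Values at least [w] come from values at
    least [w - 1], or at least [j] when [w = j]. *)
Lemma ninv_lift0 w n (j : 'I_n.+1) (s : 'S_n) : j <= w ->
  ninv w (lift_perm ord0 j s) = ninv (maxn j w.-1) s.
Proof.
move=> jw; rewrite /ninv big_ord_recl big1 ?add0n => [|b _]; last first.
  by rewrite lift_perm_id; lia.
apply: eq_bigr => a _; rewrite big_ord_recl /= ?ltn0 ?andbF add0n;
  apply: eq_bigr => b _.
by rewrite !lift_perm_lift /= /bump; lia.
Qed.

Lemma ninv0_lift0 n (j : 'I_n.+1) (s : 'S_n) :
  ninv 0 (lift_perm ord0 j s) = j + ninv 0 s.
Proof.
rewrite /ninv big_ord_recl; congr (_ + _).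
  rewrite big_ord_recl add0n (eq_bigr (fun b : 'I_n => nat_of_bool (s b < j))).
    rewrite (reindex_inj (@perm_inj _ s^-1%g)) /=.
    rewrite (eq_bigr (fun b : 'I_n => nat_of_bool (b < j))) => [|b _];
      last first.
      by rewrite permKV.
    rewrite -big_mkcond /= -(big_ord_widen n (fun=> 1)) ?sum1_card ?card_ord //.
    by rewrite -ltnS.
  by move=> b _; rewrite lift_perm_id lift_perm_lift /= /bump; lia.
apply: eq_bigr => a _; rewrite big_ord_recl /= ?ltn0 ?andbF add0n;
  apply: eq_bigr => b _.
by rewrite !lift_perm_lift /= /bump; lia.
Qed.

Lemma odd_ninv0 n (s : 'S_n) : odd (ninv 0 s) = s.
Proof.
elim: n s => [|n IHn] s.
  rewrite /ninv big_ord0 (_ : s = 1%g) ?odd_perm1 //.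
  by apply/permP => -[].
have [g _ gK] := @lift_perm_bij n ord0; rewrite -(gK s).
by rewrite ninv0_lift0 odd_lift_perm oddD IHn.
Qed.

(** Only the identity has no inversion: a first entry [j] creates [j] of them. *)
Lemma sum_ninv0_eq0 n (F : 'S_n -> nat) :
  \sum_(s : 'S_n) (ninv 0 s == 0) * F s = F 1%g.
Proof.
elim: n F => [|n IHn] F.
  rewrite (bigD1 1%g) //= big1 => [|s /eqP[]]; last by apply/permP => -[].
  by rewrite /ninv big_ord0 mul1n addn0.
rewrite (sum_lift_perm ord0) big_ord_recl /=.
rewrite [X in _ + X]big1 ?addn0 => [|j _]; last first.
  by apply: big1 => s _; rewrite ninv0_lift0.
under eq_bigr do rewrite ninv0_lift0.
by rewrite IHn lift_perm1.
Qed.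

(** * Adding a fixed point or a 2-cycle to an involution *)

Lemma involution_lift_fix n (i : 'I_n.+1) (s : 'S_n) :
  involution_perm (lift_perm i i s) = involution_perm s.
Proof.
rewrite /involution_perm lift_permV.
by apply/eqP/eqP => [/lift_perm_inj[] | <-].
Qed.

(** The inner lift puts the value 0 at position [v]; the outer one moves it to position [v + 1]. *)
Definition add_cycle n (v : 'I_n.+1) (s : 'S_n) : 'S_n.+2 :=
  lift_perm ord0 (lift ord0 v) (lift_perm v ord0 s).

Lemma add_cycleV n (v : 'I_n.+1) (s : 'S_n) :
  (add_cycle v s)^-1%g = add_cycle v s^-1.
Proof.
rewrite /add_cycle !lift_permV; apply/permP => x.
have lift2 (k : 'I_n) :
    lift ord0 (lift v k) = lift (lift ord0 v) (lift ord0 k) :> 'I_n.+2.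
  by apply/val_inj; rewrite /= /bump; lia.
case: (unliftP ord0 x) => [y|] ->.
  case: (unliftP v y) => [k|] ->.
    by rewrite {1}lift2 !lift_perm_lift lift2.
  rewrite lift_perm_lift !lift_perm_id.
  by apply/val_inj; rewrite /= /bump.
rewrite lift_perm_id (_ : ord0 = lift (lift ord0 v) ord0 :> 'I_n.+2).
  by rewrite lift_perm_lift lift_perm_id.
by apply/val_inj; rewrite /= /bump.
Qed.

Lemma involution_lift_move n (v j : 'I_n.+1) (s : 'S_n) :
  involution_perm (lift_perm ord0 (lift ord0 v) (lift_perm v j s))
    = (j == ord0) && involution_perm s.
Proof.
apply/idP/andP => [/eqP inv_s | [/eqP-> /eqP s_inv]].
  have j0 : j == ord0.
    have := lift_perm_lift ord0 (lift ord0 v) (lift_perm v j s) v.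
    rewrite {1}inv_s lift_permV lift_perm_id lift_perm_id => /(congr1 val).
    by rewrite -val_eqE /= /bump; lia.
  split=> //; move: inv_s; rewrite (eqP j0) -/(add_cycle _ _) add_cycleV.
  by case/lift_perm_inj => _ /lift_perm_inj[_ /eqP].
by rewrite /involution_perm -/(add_cycle _ _) add_cycleV -s_inv.
Qed.

Lemma add_cycle0 n (v : 'I_n.+1) (s : 'S_n) : add_cycle v s ord0 = lift ord0 v.
Proof. exact: lift_perm_id. Qed.

Lemma odd_add_cycle n (v : 'I_n.+1) (s : 'S_n) :
  add_cycle v s = ~~ s :> bool.
Proof. by rewrite !odd_lift_perm lift0 /=; case: (odd v); case: odd_perm. Qed.

Lemma ninv_lift_to0 w n (i : 'I_n.+1) (s : 'S_n) :
  ninv w.+1 (lift_perm i ord0 s) = ninv w s.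
Proof.
rewrite /ninv (bigD1_ord i) //= big1 ?add0n => [|b _]; last first.
  by rewrite lift_perm_id /= ltn0 !andbF.
apply: eq_bigr => a _; rewrite (bigD1_ord i) //= lift_perm_id /= andbF add0n.
by apply: eq_bigr => b _; rewrite !lift_perm_lift /= /bump; lia.
Qed.

Lemma ninv_add_cycle n (v : 'I_n.+1) (s : 'S_n) :
  ninv v.+1 (add_cycle v s) = ninv v s.
Proof.
rewrite ninv_lift0 ?lift0 //= (maxn_idPl _) ?leqnSn //.
exact: ninv_lift_to0.
Qed.

(** Each lift adds [ninv v s]: the outer one directly, the inner one after passing to inverses,
    which brings the value 0 to position 0. *)
Lemma nocc_add_cycle n (v : 'I_n.+1) (s : 'S_n) : involution_perm s ->
  nocc (add_cycle v s) = nocc s + (ninv v s).*2.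
Proof.
move=> /eqP s_inv; rewrite nocc_lift0 -addnn addnA; congr (_ + _).
  by rewrite -noccV lift_permV nocc_lift0 -s_inv.
exact: ninv_lift_to0.
Qed.

Lemma ninv0_add_cycle n (v : 'I_n.+1) (s : 'S_n) :
  ninv 0 (add_cycle v s) = v.*2.+1 + ninv 0 s.
Proof.
rewrite ninv0_lift0 -[ninv _ (lift_perm v _ _)]ninv0V lift_permV ninv0_lift0.
by rewrite ninv0V lift0; lia.
Qed.

Lemma sum_involution n (F : 'S_n.+2 -> nat) :
  \sum_(s : 'S_n.+2) involution_perm s * F s
    = \sum_(t : 'S_n.+1) involution_perm t * F (lift_perm ord0 ord0 t)
      + \sum_(v < n.+1) \sum_(u : 'S_n) involution_perm u * F (add_cycle v u).
Proof.
rewrite [LHS](sum_lift_perm ord0) [LHS]big_ord_recl; congr (_ + _).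
  by apply: eq_bigr => t _; rewrite involution_lift_fix.
apply: eq_bigr => v _; rewrite [LHS](sum_lift_perm v) [LHS]big_ord_recl.
rewrite [X in _ + X]big1 ?addn0 => [|j _]; last first.
  by apply: big1 => u _; rewrite involution_lift_move.
by apply: eq_bigr => u _; rewrite involution_lift_move eqxx.
Qed.

(** * Recursion for involutions with one occurrence *)

Lemma ninv0_nocc n (s : 'S_n) : ninv 0 s = 0 -> nocc s = 0.
Proof. by move=> s0; apply/nocc_ninv1/(ninv_eq0_leq _ s0). Qed.

Lemma ninv_perm1 w n : ninv w (1 : 'S_n) = 0.
Proof. by apply/eqP/ninv_eq0P => a b ab _; rewrite !perm1 ltnW. Qed.

(** For [w <= v], the entry [v + 1] at position 0 and the value [w] form a counted inversion. *)
Lemma add_cycle_ninv_eq0 n (v : 'I_n.+1) (s : 'S_n) w : ninv v s = 0 ->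
  (ninv w (add_cycle v s) == 0) = (v < w).
Proof.
move=> s0; have c0 := add_cycle0 v s.
case: (ltnP v w) => [vw | wv].
  by apply/eqP/(ninv_eq0_leq vw); rewrite ninv_add_cycle.
apply/negP => /ninv_eq0P cP; set c := add_cycle v s in c0 cP.
have lt_w : w < n.+2 by rewrite (leq_ltn_trans wv) // ltnW // ltnS.
pose b := (c^-1)%g (Ordinal lt_w).
have cb : c b = w :> nat by rewrite /b permKV.
have b0 : 0 < b.
  rewrite lt0n; apply: contraTneq wv => b0.
  by rewrite -cb (_ : b = ord0) ?c0 ?lift0 -?ltnNge //; apply/val_inj.
by have := cP ord0 b b0; rewrite cb c0 lift0 => /(_ (leqnn _)); lia.
Qed.

(* [p] is the parity of the permutation, [true] meaning odd. *)
Definition once_count (p : bool) (n w : nat) : nat :=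
  \sum_(s : 'S_n) involution_perm s *
    [&& odd_perm s == p, nocc s == 1 & ninv w s == 0].

Lemma once_count_small p n w : w <= 1 -> once_count p n w = 0.
Proof.
move=> w1; apply: big1 => s _.
case: (ninv w s =P 0) => [s0 | _]; last by rewrite !andbF muln0.
by rewrite (nocc_ninv1 (ninv_eq0_leq w1 s0)) andbF muln0.
Qed.

(** This counts what remains after deleting a fixed point 0. Only the transposition of 0 and 1
    survives: it is odd, needs two points, and its inversion involves the value 0, below [w]. *)
Lemma once_count_fix p n w : 0 < w ->
  \sum_(t : 'S_n) involution_perm t *
     [&& odd_perm t == p, nocc t + ninv 0 t == 1 & ninv w t == 0]
  = p && (1 < n).
Proof.
move=> w0.
(* This sum arises when [t] itself fixes 0; without inversions there is no occurrence, so it cannot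
   be 1. *)
have noc (k : nat) (s : 'S_k) : (nocc s + ninv 0 s + ninv 0 s == 1) = false.
  by have := @ninv0_nocc _ s; lia.
case: n => [|[|n]].
- rewrite andbF; apply: big1 => s _.
  by rewrite /nocc /ninv !big_ord0 andbF muln0.
- rewrite andbF (sum_lift_perm ord0); apply: big1 => j _; apply: big1 => s _.
  rewrite nocc_lift0 ninv0_lift0 (ord1 j) add0n noc.
  by rewrite andbF muln0.
rewrite sum_involution big1 ?add0n => [|s _]; last first.
  by rewrite nocc_lift0 ninv0_lift0 add0n noc andbF muln0.
(* The cycle brings [2v + 1] inversions, so [v = 0] and the rest is the identity. *)
rewrite big_ord_recl [X in _ + X]big1 ?addn0 => [|v _]; last first.
  by apply: big1 => s _; rewrite ninv0_add_cycle lift0 doubleS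
    !addnS andbF muln0.
pose G (s : 'S_n) : nat := involution_perm s *
  (let c := add_cycle ord0 s in
   [&& odd_perm c == p, nocc c + ninv 0 c == 1 & ninv w c == 0]).
transitivity (\sum_(s : 'S_n) (ninv 0 s == 0) * G s).
  apply: eq_bigr => s _; rewrite /G; case: (ninv 0 s =P 0) => s0.
    by rewrite mul1n.
  by rewrite ninv0_add_cycle add1n addnS eqSS addn_eq0 (introF eqP s0)
    !andbF muln0.
have inv1 : involution_perm (1 : 'S_n) by rewrite /involution_perm invg1.
rewrite sum_ninv0_eq0 /G inv1 mul1n odd_add_cycle odd_perm1.
rewrite nocc_add_cycle // ninv0_add_cycle !ninv_perm1 ninv0_nocc ?ninv_perm1 //.
by rewrite add_cycle_ninv_eq0 ?ninv_perm1 // w0; case: p {G}.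
Qed.

Lemma once_countSS p n w : 1 < w ->
  once_count p n.+2 w
    = (p && (0 < n)) + \sum_(v < n.+1 | v < w) once_count (~~ p) n v.
Proof.
move=> w1; rewrite /once_count sum_involution; congr (_ + _).
  rewrite -(@once_count_fix p n.+1 w.-1) -?subn1 ?subn_gt0 //.
  apply: eq_bigr => t _; rewrite nocc_lift0 ninv_lift0 // max0n odd_lift_perm.
  by rewrite subn1.
rewrite [RHS]big_mkcond; apply: eq_bigr => v _; case: ifP => vw; last first.
  apply: big1 => s _; case: (boolP (involution_perm s)) => //= s_inv.
  rewrite nocc_add_cycle //; case: (ninv v s =P 0) => [s0|s0].
    by rewrite add_cycle_ninv_eq0 // vw !andbF.
  (* The cycle adds an even, nonzero number of occurrences. *)
  by rewrite (_ : _ == 1 = false) ?andbF //; lia.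
apply: eq_bigr => s _; case: (boolP (involution_perm s)) => //= s_inv.
rewrite nocc_add_cycle // odd_add_cycle; case: (ninv v s =P 0) => [s0|s0].
  by rewrite s0 addn0 add_cycle_ninv_eq0 // vw; case: odd_perm p => -[].
by rewrite (_ : _ == 1 = false) ?andbF //; lia.
Qed.

(** The two sums of [once_countSS] differ by the summand [v = w], which is in range when
    [w + 1 < n]. *)
Lemma once_countS p n w : 1 < w -> w < n ->
  once_count p n w.+1
    = once_count p n w + (if w.+1 < n then once_count (~~ p) (n - 2) w else 0).
Proof.
case: n => [|[|n]] w1 wn; try by lia.
rewrite subn2 /= !(@once_countSS p n) //; last exact: ltnW.
rewrite -addnA !ltnS; congr (_ + _).
have widen k (kn : k <= n.+1) (F : nat -> nat) :
    \sum_(v < n.+1 | v < k) F v = \sum_(v < k) F v.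
  by rewrite (big_ord_widen n.+1 F).
case: ltnP => wn'; last first.
  by rewrite !widen ?big_ord_recr // ltnW.
by rewrite addn0; apply: eq_bigl => v; have := ltn_ord v; lia.
Qed.

(** * Lattice paths and the reflection principle *)

(* Number of paths with [m] steps from height [d], [c] of them down steps,
   that stay nonnegative and end at a positive height. *)
Fixpoint npath (c d m : nat) : nat :=
  if m is m'.+1 then
    npath c d.+1 m' +
      (if c is c'.+1 then if d is d'.+1 then npath c' d' m' else 0 else 0)
  else (c == 0) && (0 < d).

Lemma npath_eq0 c d m : d + m <= c.*2 -> npath c d m = 0.
Proof.
elim: m c d => [|m IHm] [|c] [|d] //= le_c; rewrite ?IHm //; lia.
Qed.

(* Reflection principle: the subtracted binomial counts the paths that reach
   height -1. *)
Lemma npathE c d m : c.*2 < d + m ->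
  npath c d m + (if d < c then 'C(m, c - d.+1) else 0) = 'C(m, c).
Proof.
elim: m c d => [|m IHm] [|c] [|d] lt_c; try by lia.
- by [].
- by rewrite !bin0n; case: ifP => /=; lia.
- by rewrite bin0; have /= := IHm 0 1 isT; rewrite bin0; lia.
- by rewrite bin0; have /= := IHm 0 d.+2 isT; rewrite bin0; lia.
- rewrite /= subn1 binS; have /= := IHm c.+1 1.
  by rewrite !ltnS; case: c lt_c => [|c] lt_c;
    rewrite ?bin0 //= ?binS ?subSS ?subn0; lia.
rewrite /= binS -(IHm c.+1 d.+2) -?(IHm c d); try by lia.
rewrite !ltnS !subSS; case: (ltngtP d.+1 c) => [dc|dc|<-].
- by rewrite -(subnSK dc) binS; lia.
- by lia.
- by rewrite subnn !bin0; lia.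
Qed.

(** The height is [n] minus the threshold. In [once_countS], keeping [n] is an up step; deleting a
    2-cycle lowers [n] by 2 and is a down step. At threshold 2 only [0 2 1 3 ...] is left; it is odd
    and needs [n > 2], whence [odd c == ~~ p] and the positive end height. The induction uses two
    different bounds [k]. *)
Lemma once_countE p n w k : w.+2 <= n -> n <= k ->
  once_count p n w.+2
    = \sum_(c < k | odd c == ~~ p) npath c (n - w.+2) w.
Proof.
elim: w p n k => [|w IHw] p n k wn nk.
  case: n wn nk => [|[|n]] // _ nk; rewrite once_countSS // big1 => [|v];
    last first.
    exact: once_count_small.
  rewrite addn0 subn2 big_mkcond; case: k nk => // k _.
  rewrite big_ord_recl big1 ?addn0 => [|c _]; last by rewrite if_same.
  by rewrite /= addn0; case: p; case: n => [|n] //.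
rewrite once_countS //; case: k nk => [|k] nk; first by lia.
rewrite (IHw _ _ k.+1) //; last exact: ltnW.
transitivity (\sum_(c < k.+1 | odd c == ~~ p) npath c (n - w.+2) w
  + \sum_(c < k | odd c == p) (if w.+3 < n
    then npath c (n - w.+2.+2) w else 0)).
  congr (_ + _); case: ifP => wn'; last by rewrite big1.
  rewrite (IHw _ _ k) ?negbK; try lia.
  by apply: eq_bigr => c _; rewrite -subnDA.
have -> : n - w.+2 = (n - w.+3).+1 by lia.
rewrite big_mkcond [X in _ + X]big_mkcond [RHS]big_mkcond /=.
rewrite [RHS](eq_bigr (fun c : 'I_k.+1 =>
  (if odd c == ~~ p then npath c (n - w.+3).+1 w else 0) +
  (if odd c == ~~ p then
     if nat_of_ord c is c'.+1 then
       if w.+3 < n then npath c' (n - w.+4) w else 0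
     else 0
   else 0))) => [|c _].
  rewrite big_split; congr (_ + _);
    rewrite [RHS]big_ord_recl [X in _ = X + _]/= if_same add0n.
  by apply: eq_bigr => c _; rewrite lift0 /=; case: (odd c); case: p.
case: ifP => // _; congr (_ + _); case: (nat_of_ord c) => // c'.
case: ltnP => wn'; first by rewrite (_ : n - w.+3 = (n - w.+4).+1) //; lia.
by rewrite (_ : n - w.+3 = 0) //; lia.
Qed.

(** By [npathE] each term is ['C(N, c) - 'C(N, c - 2)], valid up to [c = m] since [2m <= N]; the
    terms vanish from [c = m + 2] on since [N < 2m + 4]. *)
Lemma sum_npath m N k : m.*2 <= N < m.*2 + 4 -> m < k ->
  \sum_(c < k | odd c == odd m) npath c 1 N = 'C(N, m).
Proof.
case/andP=> mN Nm mk.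
transitivity (\sum_(c < m.+1 | odd c == odd m) npath c 1 N).
  rewrite [RHS](big_ord_widen_cond k (fun c => odd c == odd m)
    (fun c => npath c 1 N)) // [RHS]big_mkcondr; apply: eq_bigr => c /eqP eq_cm.
  case: ltnP => // mc; apply: npath_eq0.
  have : c <> m.+1 :> nat by move=> cm; move: eq_cm; rewrite cm /=; case: odd.
  lia.
elim/ltn_ind: m mN {Nm mk} => -[|[|m]] IHm mN.
- rewrite big_mkcond big_ord_recr big_ord0 /=.
  by rewrite -(@npathE 0 1 N) //= !addn0; lia.
- rewrite big_mkcond !big_ord_recr big_ord0 /=.
  by rewrite -(@npathE 1 1 N) //= !addn0; lia.
rewrite big_mkcond 2!big_ord_recr -big_mkcond /= negbK.
rewrite IHm //; try by lia.
rewrite eqxx; case: (odd m) => /=;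
  rewrite ?addn0 -(@npathE m.+2 1 N) ?subn2 //=; lia.
Qed.

(** * Evaluation at threshold [n - 1] *)

Lemma once_count_bin p n m : 3 <= n -> m.*2 <= n - 3 < m.*2 + 4 ->
  odd m = ~~ p ->
  once_count p n n.-1 = 'C(n - 3, m).
Proof.
case: n => [|[|[|n]]] // _ mn odd_m.
rewrite (@once_countE p n.+3 n n.+3) // -odd_m -(@sum_npath m _ n.+3) //;
  last by lia.
have -> : n.+3 - n.+2 = 1 by lia.
by rewrite !subSS subn0.
Qed.

Lemma once_count_card p n :
  #|[set s : 'S_n | [&& involution_perm s, odd #|inversions s| == p
                      & contains132_once s]]| = once_count p n n.-1.
Proof.
rewrite -sum1_card big_mkcond; apply: eq_bigr => s _.
rewrite inE /contains132_once card_inversions card_occurrences132 odd_ninv0.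
(* Two distinct values below [n] cannot both be at least [n - 1]. *)
have -> : ninv n.-1 s == 0.
  apply/ninv_eq0P => a b _; have := ltn_ord (s a); lia.
by rewrite andbT mulnb; case: andP.
Qed.

Theorem theorem2p7 :
  (forall n : nat, 5 <= n ->
     #|[set s : 'S_n | [&& involution_perm s, even_by_inversions s
                         & contains132_once s]]|
     = 'C(n - 3, 1 + 2 * ((n - 5) %/ 4)))
  /\
  (forall n : nat, 3 <= n ->
     #|[set s : 'S_n | [&& involution_perm s, odd_by_inversions s
                         & contains132_once s]]|
     = 'C(n - 3, 2 * ((n - 3) %/ 4))).
Proof.
split=> n n_ge.
  (* Here [m] is the odd number with [2m <= n - 3 < 2m + 4]; for odd involutions it is the even
     one. *)
  rewrite -(@once_count_bin false n) //; try by lia.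
  rewrite -once_count_card; apply: eq_card => s; rewrite !inE.
  by rewrite /even_by_inversions; case: odd.
rewrite -(@once_count_bin true n) //; try by lia.
rewrite -once_count_card; apply: eq_card => s; rewrite !inE.
by rewrite /odd_by_inversions; case: odd.
Qed.
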